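(* Let $A\subseteq\mathbf{R}$ be such that $A\times A$ is a bounded subset of $\mathbf{R}^2$, and let $f:A\times A\to\mathbf{R}$ be a factorable double function. Then $f$ is uniformly continuous on $A\times A$ if and only if $f$ preserves factorable slowly oscillating double sequences from $A\times A$, i.e. if and only if for every factorable slowly oscillating double sequence $\{x_{k,l}\}$ of points of $A\times A$ the double sequence $\{f(x_{k,l})\}$ of real numbers is slowly oscillating.
   Context: A double sequence is a family $\{x_{k,l}\}$ indexed by pairs of positive integers $k,l$. Write $|\cdot|$ for the absolute value on $\mathbf{R}$ and for the Euclidean norm on $\mathbf{R}^2$. A double sequence $\{x_{k,l}\}$ of points of $\mathbf{R}$ (or of $\mathbf{R}^2$) is slowly oscillating if for every $\varepsilon>0$ there exist $\alpha=\alpha(\varepsilon)>0$, $\delta=\delta(\varepsilon)>0$ and a positive integer $N=N(\varepsilon)$ such that $|x_{k,l}-x_{s,t}|<\varepsilon$ for all positive integers $k,l,s,t$ with $k,l\ge N$, $k\le s\le(1+\alpha)k$ and $l\le t\le(1+\delta)l$. A function $f:A\times A\to\mathbf{R}$ is a factorable double function (two dimensional factorable real-valued function) if there are functions $g,h:A\to\mathbf{R}$ with $f(x,y)=g(x)h(y)$ for all $x,y\in A$. A double sequence $\{x_{k,l}\}$ of points of $A\times A$ is factorable if there are single sequences $(a_k)$, $(b_l)$ in $A$ with $x_{k,l}=(a_k,b_l)$ for all $k,l$. Uniform continuity is with respect to the Euclidean distance on $\mathbf{R}^2$. *)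

(* Defs.v *)
From Stdlib Require Import Reals.
From Coquelicot Require Import Coquelicot.
Open Scope R_scope.

(** Real analysis over Stdlib's [R], with Coquelicot's normed modules.  The
    canonical norm is [Rabs] on [R] and, on [R * R], the Euclidean norm (Coquelicot's
    product *uniform space*, by contrast, uses the max of the two distances, so
    everything below is phrased with [norm] rather than [ball]). *)
Lemma norm_R2_euclidean (x y : R) :
  norm ((x, y) : R * R) = sqrt (x ^ 2 + y ^ 2).
Proof.
  change (sqrt (Rabs x ^ 2 + Rabs y ^ 2) = sqrt (x ^ 2 + y ^ 2)).
  now rewrite !pow2_abs.
Qed.

Definition square (A : R -> Prop) (p : R * R) : Prop := A (fst p) /\ A (snd p).

Definition bounded_subset {V : NormedModule R_AbsRing} (S : V -> Prop) : Prop :=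
  exists M : R, forall p : V, S p -> norm p <= M.

(** A function on a subset is represented by a total function; only its values
    on the subset are ever used. *)
Definition uniformly_continuous_on {V W : NormedModule R_AbsRing}
    (S : V -> Prop) (f : V -> W) : Prop :=
  forall eps : R, 0 < eps ->
  exists delta : R, 0 < delta /\
    forall p q : V, S p -> S q ->
      norm (minus p q) < delta -> norm (minus (f p) (f q)) < eps.

(** Double sequences are indexed by the positive integers: they are represented
    by functions on [nat] whose values at index [0] are irrelevant. *)
Definition dseq_in {V : Type} (S : V -> Prop) (x : nat -> nat -> V) : Prop :=
  forall k l : nat, (0 < k)%nat -> (0 < l)%nat -> S (x k l).

(** Since [N] is positive, so are all the indices [k], [l], [s], [t]. *)
Definition slowly_oscillating {V : NormedModule R_AbsRing}
    (x : nat -> nat -> V) : Prop :=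
  forall eps : R, 0 < eps ->
  exists (alpha delta : R) (N : nat),
    0 < alpha /\ 0 < delta /\ (0 < N)%nat /\
    forall k l s t : nat,
      (N <= k)%nat -> (N <= l)%nat ->
      (k <= s)%nat -> INR s <= (1 + alpha) * INR k ->
      (l <= t)%nat -> INR t <= (1 + delta) * INR l ->
      norm (minus (x k l) (x s t)) < eps.

Definition factorable_function (A : R -> Prop) (f : R * R -> R) : Prop :=
  exists g h : R -> R, forall x y : R, A x -> A y -> f (x, y) = g x * h y.

Definition factorable_dseq (A : R -> Prop) (x : nat -> nat -> R * R) : Prop :=
  exists a b : nat -> R,
    (forall k : nat, (0 < k)%nat -> A (a k)) /\
    (forall l : nat, (0 < l)%nat -> A (b l)) /\
    (forall k l : nat, (0 < k)%nat -> (0 < l)%nat -> x k l = (a k, b l)).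

Definition preserves_factorable_slowly_oscillating
    (A : R -> Prop) (f : R * R -> R) : Prop :=
  forall x : nat -> nat -> R * R,
    dseq_in (square A) x -> factorable_dseq A x -> slowly_oscillating x ->
    slowly_oscillating (fun k l : nat => f (x k l)).

(* Main.v *)
Require Import Defs.
From Stdlib Require Import Reals.
From Coquelicot Require Import Coquelicot.
From Stdlib Require Import Lra Lia Classical ClassicalEpsilon.
Open Scope R_scope.

(** If the oscillation of [f] at a point [(c, e)] of the plane is at least [eps],
    there are points [p k], [q k] of [A x A] converging to [(c, e)] with
    [|f (p k) - f (q k)| >= eps].  Interleaving them coordinatewise gives single
    sequences [a], [b] in [A] that converge to [c] and [e], so [(a k, b l)] is
    slowly oscillating, while on the diagonal [f (a k, b k)] and
    [f (a (S k), b (S k))] are [eps]-apart for every even [k].  Hence a preserving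
    [f] has zero oscillation at every point, and compactness of a square
    containing the bounded set [A x A] makes this uniform. *)

Lemma Rabs_fst_le_norm (x y : R) : Rabs x <= norm ((x, y) : R * R).
Proof.
  rewrite norm_R2_euclidean, <- sqrt_Rsqr_abs.
  apply sqrt_le_1_alt; unfold Rsqr; nra.
Qed.

Lemma Rabs_snd_le_norm (x y : R) : Rabs y <= norm ((x, y) : R * R).
Proof.
  rewrite norm_R2_euclidean, <- sqrt_Rsqr_abs.
  apply sqrt_le_1_alt; unfold Rsqr; nra.
Qed.

Lemma norm_le_Rabs_plus (x y : R) : norm ((x, y) : R * R) <= Rabs x + Rabs y.
Proof.
  rewrite norm_R2_euclidean, <- (pow2_abs x), <- (pow2_abs y).
  pose proof (Rabs_pos x); pose proof (Rabs_pos y).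
  rewrite <- (sqrt_pow2 (Rabs x + Rabs y)) by lra.
  apply sqrt_le_1_alt; nra.
Qed.

(** Convergent coordinates are Cauchy, so any window sizes will do, here [1] and [1]. The difference
    is split into four distances to the limits, each below [eps / 4]. *)
Lemma slowly_oscillating_pair_of_lim (a b : nat -> R) (c e : R) :
  is_lim_seq a c -> is_lim_seq b e ->
  slowly_oscillating (fun k l : nat => (a k, b l) : R * R).
Proof.
  intros Ha Hb eps Heps.
  apply is_lim_seq_spec in Ha; apply is_lim_seq_spec in Hb.
  assert (H4 : 0 < eps / 4) by lra.
  destruct (Ha (mkposreal _ H4)) as [Na HNa].
  destruct (Hb (mkposreal _ H4)) as [Nb HNb].
  simpl in HNa, HNb.
  exists 1, 1, (S (Na + Nb)); repeat split; try lra; try lia.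
  intros k l s t Hk Hl Hks _ Hlt _.
  pose proof (HNa k ltac:(lia)); pose proof (HNa s ltac:(lia)).
  pose proof (HNb l ltac:(lia)); pose proof (HNb t ltac:(lia)).
  apply Rle_lt_trans with (1 := norm_le_Rabs_plus (a k - a s) (b l - b t)).
  split_Rabs; lra.
Qed.

(** The [pred] puts [u k] and [v k], with the same index, at the consecutive places [k] and [S k]
    whenever [k] is even. *)
Definition interleave {T : Type} (u v : nat -> T) (k : nat) : T :=
  if Nat.even k then u k else v (pred k).

Lemma interleave_ind {T : Type} (P : T -> Prop) (u v : nat -> T) :
  (forall n, P (u n)) -> (forall n, P (v n)) ->
  forall k, P (interleave u v k).
Proof. intros Hu Hv k; unfold interleave; destruct (Nat.even k); auto. Qed.

Lemma is_lim_seq_interleave (u v : nat -> R) (c : R) :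
  is_lim_seq u c -> is_lim_seq v c -> is_lim_seq (interleave u v) c.
Proof.
  intros Hu Hv.
  apply is_lim_seq_spec in Hu; apply is_lim_seq_spec in Hv.
  apply is_lim_seq_spec; intros eps.
  destruct (Hu eps) as [Nu HNu], (Hv eps) as [Nv HNv].
  exists (S (Nu + Nv)); intros n Hn; unfold interleave.
  destruct (Nat.even n); [apply HNu | apply HNv]; lia.
Qed.

Lemma is_lim_seq_of_Rabs_lt_inv (u : nat -> R) (c : R) :
  (forall n, Rabs (u n - c) < / (INR n + 1)) -> is_lim_seq u c.
Proof.
  intros Hu; apply is_lim_seq_spec; intros eps.
  destruct (archimed_cor1 eps (cond_pos eps)) as [N [HN HN0]].
  exists N; intros n Hn.
  apply Rlt_trans with (1 := Hu n), Rlt_trans with (2 := HN).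
  apply lt_INR in HN0; apply le_INR in Hn; simpl in HN0.
  apply Rinv_lt_contravar; nra.
Qed.

(** The step from [k] to [S k] stays inside both windows once [alpha * INR k] and [delta * INR k]
    reach [1]. Evenness matches the pairing made by [interleave]. *)
Lemma slowly_oscillating_diag_even {V : NormedModule R_AbsRing}
    (x : nat -> nat -> V) (eps : R) :
  slowly_oscillating x -> 0 < eps ->
  exists k : nat, Nat.even k = true /\
    norm (minus (x k k) (x (S k) (S k))) < eps.
Proof.
  intros Hx Heps.
  destruct (Hx eps Heps) as (alpha & delta & N & Hal & Hde & HN & H).
  destruct (INR_unbounded (/ alpha)) as [m1 Hm1].
  destruct (INR_unbounded (/ delta)) as [m2 Hm2].
  set (k := (2 * (N + m1 + m2))%nat).
  assert (H1 : 1 <= alpha * INR k).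
  { rewrite <- (Rinv_r alpha) by lra.
    apply Rmult_le_compat_l; [lra |].
    apply Rle_trans with (INR m1); [lra | apply le_INR; lia]. }
  assert (H2 : 1 <= delta * INR k).
  { rewrite <- (Rinv_r delta) by lra.
    apply Rmult_le_compat_l; [lra |].
    apply Rle_trans with (INR m2); [lra | apply le_INR; lia]. }
  exists k; split; [apply Nat.even_even |].
  apply H; rewrite ?S_INR; try lia; lra.
Qed.

(** Two nearby values of [f] are compared with each other, not with [f (c, e)], so that the centre
    may be a limit point outside [square A], as the compactness argument requires. *)
Lemma preserving_oscillation_zero (A : R -> Prop) (f : R * R -> R) (c e eps : R) :
  preserves_factorable_slowly_oscillating A f -> 0 < eps ->
  exists d : posreal, forall p q : R * R, square A p -> square A q ->
    Rabs (fst p - c) < d -> Rabs (snd p - e) < d ->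
    Rabs (fst q - c) < d -> Rabs (snd q - e) < d ->
    Rabs (f p - f q) < eps.
Proof.
  intros Hf Heps; apply NNPP; intros Hno.
  set (good := fun (n : nat) (p : R * R) => square A p /\
         Rabs (fst p - c) < / (INR n + 1) /\ Rabs (snd p - e) < / (INR n + 1)).
  assert (Hex : forall n, exists pq : (R * R) * (R * R),
            good n (fst pq) /\ good n (snd pq) /\
            eps <= Rabs (f (fst pq) - f (snd pq))).
  { intros n; apply NNPP; intros Hn; apply Hno.
    exists (mkposreal _ (RinvN_pos n)); simpl.
    intros p q Hp Hq Hp1 Hp2 Hq1 Hq2.
    apply Rnot_le_lt; intros Hle; apply Hn.
    exists (p, q); unfold good; simpl; tauto. }
  pose (w := fun n => proj1_sig (constructive_indefinite_description _ (Hex n))).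
  assert (Hw : forall n, good n (fst (w n)) /\ good n (snd (w n)) /\
                 eps <= Rabs (f (fst (w n)) - f (snd (w n)))).
  { intros n; exact (proj2_sig (constructive_indefinite_description _ (Hex n))). }
  clearbody w; unfold good, square in Hw.
  set (a := interleave (fun n => fst (fst (w n))) (fun n => fst (snd (w n)))).
  set (b := interleave (fun n => snd (fst (w n))) (fun n => snd (snd (w n)))).
  assert (HaA : forall k, A (a k)) by (apply interleave_ind; apply Hw).
  assert (HbA : forall k, A (b k)) by (apply interleave_ind; apply Hw).
  assert (Hac : is_lim_seq a c).
  { apply is_lim_seq_interleave; apply is_lim_seq_of_Rabs_lt_inv; apply Hw. }
  assert (Hbe : is_lim_seq b e).
  { apply is_lim_seq_interleave; apply is_lim_seq_of_Rabs_lt_inv; apply Hw. }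
  assert (Hso : slowly_oscillating (fun k l : nat => f (a k, b l))).
  { apply (Hf (fun k l => (a k, b l))).
    - intros k l _ _; split; [apply HaA | apply HbA].
    - exists a, b; auto.
    - exact (slowly_oscillating_pair_of_lim a b c e Hac Hbe). }
  destruct (slowly_oscillating_diag_even _ eps Hso Heps) as [k [Hk Hlt]].
  (* For even [k], the diagonal terms at [k] and [S k] are the values of [f] at the two points of
     [w k], which are at least [eps] apart. *)
  revert Hlt; unfold a, b, interleave.
  rewrite Nat.even_succ, <- Nat.negb_even, Hk; simpl.
  rewrite <- !surjective_pairing.
  apply Rle_not_lt, Hw.
Qed.

Theorem theorem3p3 (A : R -> Prop) (f : R * R -> R)
    (hA : bounded_subset (square A))
    (hf : factorable_function A f) :
  uniformly_continuous_on (square A) f <->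
  preserves_factorable_slowly_oscillating A f.
Proof.
  split.
  - intros Huc x Hx _ Hso eps Heps.
    destruct (Huc eps Heps) as (eta & Heta & Hf).
    destruct (Hso eta Heta) as (alpha & delta & N & Hal & Hde & HN & H).
    exists alpha, delta, N; repeat split; try assumption.
    intros k l s t Hk Hl Hks Hs Hlt Ht.
    apply Hf; [apply Hx; lia | apply Hx; lia | now apply H].
  - intros Hf eps Heps.
    destruct hA as [M HM].
    (* The factor [2] leaves room for a second point: one point within [d] of the centre and another
       within [d] of the first both satisfy the bounds. *)
    assert (Hex : forall c e : R, exists d : posreal,
      forall p q : R * R, square A p -> square A q ->
        Rabs (fst p - c) < 2 * d -> Rabs (snd p - e) < 2 * d ->
        Rabs (fst q - c) < 2 * d -> Rabs (snd q - e) < 2 * d ->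
        Rabs (f p - f q) < eps).
    { intros c e.
      destruct (preserving_oscillation_zero A f c e eps Hf Heps) as [d Hd].
      exists (pos_div_2 d).
      replace (2 * pos_div_2 d) with (pos d) by (simpl; field).
      exact Hd. }
    pose (rad := fun c e =>
      proj1_sig (constructive_indefinite_description _ (Hex c e))).
    pose proof (fun c e =>
      proj2_sig (constructive_indefinite_description _ (Hex c e))) as Hrad.
    change (forall c e : R, forall p q : R * R, square A p -> square A q ->
        Rabs (fst p - c) < 2 * rad c e -> Rabs (snd p - e) < 2 * rad c e ->
        Rabs (fst q - c) < 2 * rad c e -> Rabs (snd q - e) < 2 * rad c e ->
        Rabs (f p - f q) < eps) in Hrad.
    clearbody rad.
    (* [d] acts as a Lebesgue number: each point of the closed square is within [rad u v],
       coordinatewise, of some [(u, v)] with [d <= rad u v]. This existence comes doubly negated,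
       hence [NNPP] below. *)
    destruct (compactness_value_2d (- M) M (- M) M rad) as [d Hd].
    exists d; split; [apply cond_pos |].
    intros [x y] [x' y'] Hp Hq Hpq.
    assert (Hxx : Rabs (x - x') < d)
      by exact (Rle_lt_trans _ _ _ (Rabs_fst_le_norm (x - x') (y - y')) Hpq).
    assert (Hyy : Rabs (y - y') < d)
      by exact (Rle_lt_trans _ _ _ (Rabs_snd_le_norm (x - x') (y - y')) Hpq).
    pose proof (Rle_trans _ _ _ (Rabs_fst_le_norm x y) (HM _ Hp)) as HxM.
    pose proof (Rle_trans _ _ _ (Rabs_snd_le_norm x y) (HM _ Hp)) as HyM.
    apply Rabs_le_between in HxM; apply Rabs_le_between in HyM.
    destruct (NNPP _ (Hd x y HxM HyM)) as (u & v & _ & _ & Hxu & Hyv & Hdr).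
    pose proof (cond_pos (rad u v)).
    apply (Hrad u v (x, y) (x', y') Hp Hq); simpl; split_Rabs; lra.
Qed.
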